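(* Let $G=(N,T,P,S)$ be a context-free grammar in Chomsky normal form, and let $G'=(N',T,P',S)$ be its equivalent in Dyck normal form, that is, the grammar in Dyck normal form with $L(G')=L(G)$ obtained from $G$ by the conversion procedure described in the context. Then there exists a homomorphism $h_d: N'\cup T\to N\cup T$ such that any derivation tree (in $G$) of a word $w\in L(G)$ is the homomorphic image under $h_d$ of a derivation tree of the same word $w$ in $G'$.
   Context: A context-free grammar $G=(N,T,P,S)$ consists of disjoint finite sets $N$ (nonterminals) and $T$ (terminals), an axiom $S\in N$, and a finite set of productions $P\subseteq N\times(N\cup T)^*$; $L(G)\subseteq T^*$ is the generated language, and $\lambda$ denotes the empty string. $G$ is in Chomsky normal form if every rule has the form $A\to BC$ or $A\to a$ with $A,B,C\in N$, $a\in T$, where in addition the rule $S\to\lambda$ is allowed provided $S$ does not occur on the right-hand side of any rule. $G$ is in Dyck normal form if: (1) $G$ is in Chomsky normal form; (2) if $A\to a\in P$ with $A\in N$, $A\ne S$, $a\in T$, then no other rule in $P$ rewrites $A$; (3) for each $A\in N$ such that $X\to AB\in P$ (respectively $X\to BA\in P$) there is no rule in $P$ of the form $X'\to B'A$ (respectively $X'\to AB'$); that is, no nonterminal occurs both as the left and as the right symbol of right-hand sides of length two; (4) for any rules $X\to AB$ and $X'\to A'B$ in $P$ one has $A=A'$, and for any rules $X\to AB$ and $X'\to AB'$ in $P$ one has $B=B'$. Conversion procedure from a grammar $G$ in Chomsky normal form to $G'$ in Dyck normal form (the axiom $S$ and the terminals are kept; $N'$ and $P'$ are the nonterminals and rules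 present at the end). Step 1 (for condition (2), nonterminals $A\neq S$). If there are several rules $A\to a$, $A\to b$ with $a\ne b$, then for each such $A\to b$ perform an $A_b$-terminal substitution of $A$: introduce a new nonterminal $A_b$, add $A_b\to b$, remove $A\to b$, and, keeping the existing rules, add $X\to A_bB$ for each rule $X\to AB$, add $X\to BA_b$ for each rule $X\to BA$, and add $X\to A_bA$, $X\to AA_b$, $X\to A_bA_b$ for each rule $X\to AA$. Then, if a rule $A\to a$ coexists with a rule $A\to B_1B_2$, perform in the same way an $A_a$-terminal substitution of $A$ for the rule $A\to a$. Step 2 (for condition (3)). If $A$ occurs both as a left and as a right symbol of right-hand sides of length two, keep only its left occurrences: for each rule $X'\to B'A$ perform a ${}_{B'}A$-nonterminal substitution of $A$, i.e. replace the rule by $X'\to B'\,{}_{B'}A$, where ${}_{B'}A$ is a new nonterminal, and for every rule $A\to Y$ add ${}_{B'}A\to Y$, keeping $A\to Y$. Step 3 (for condition (4)). For any two rules $X\to AB$, $X'\to A'B$ (respectively $X\to BA$, $X'\to BA'$) with $A\neq A'$, introduce a new nonterminal ${}_{A'}B$ (respectively $B_{A'}$) that replaces $B$ in the second rule, and for every rule $B\to Y$ add ${}_{A'}B\to Y$ (respectively $B_{A'}\to Y$), keeping $B\to Y$ (again a nonterminal substitution of $B$). If $A'$ is also paired, in another rule, with a nonterminal different from the new one, the procedure is repeated for $A'$. The homomorphic image of a derivation tree under a map $h_d:N'\cup T\to N\cup T$ is the ordered tree of the same shape in which each node label $x\in N'\cup T$ is replaced by $h_d(x)$ (a leaf labelled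 $\lambda$ keeps its label). *)

(* Defs.v *)
From mathcomp Require Import all_boot finmap.
From Stdlib Require Import Relation_Operators.
From Stdlib Require List.

Set Implicit Arguments.
Unset Strict Implicit.
Unset Printing Implicit Defensive.

Local Open Scope fset_scope.

(* All symbols live in an ambient type V, so that the grammars produced by the
   conversion literally extend the nonterminal set of the original one. *)
Record cfg (V : choiceType) := Cfg {
  nonterms : {fset V};
  terms : {fset V};
  start : V;
  rules : {fset V * seq V};
  cfg_disjoint : [disjoint nonterms & terms]%fset;
  cfg_start : start \in nonterms;
  cfg_rules : forall A Y, (A, Y) \in rules ->
    A \in nonterms /\ {subset Y <= nonterms `|` terms}
}.

Inductive derives1 (V : choiceType) (G : cfg V) : seq V -> seq V -> Prop :=
| Derives1 u v A Y : (A, Y) \in rules G ->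
    derives1 G (u ++ A :: v) (u ++ Y ++ v).

Definition lang (V : choiceType) (G : cfg V) (w : seq V) : Prop :=
  {subset w <= terms G} /\
  clos_refl_trans (seq V) (derives1 G) [:: start G] w.

Definition chomsky (V : choiceType) (G : cfg V) : Prop :=
  forall A Y, (A, Y) \in rules G ->
    [\/ exists B C, [/\ B \in nonterms G, C \in nonterms G & Y = [:: B; C]],
        exists2 a, a \in terms G & Y = [:: a]
      | [/\ A = start G, Y = [::]
          & forall X Z, (X, Z) \in rules G -> start G \notin Z]].

Definition dyck (V : choiceType) (G : cfg V) : Prop :=
  [/\ chomsky G,
      forall A a Y, a \in terms G -> A <> start G ->
        (A, [:: a]) \in rules G -> (A, Y) \in rules G -> Y = [:: a],
      forall X X' A B B',
        (X, [:: A; B]) \in rules G -> (X', [:: B'; A]) \notin rules G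
    & (forall X X' A A' B, (X, [:: A; B]) \in rules G ->
         (X', [:: A'; B]) \in rules G -> A = A') /\
      (forall X X' A B B', (X, [:: A; B]) \in rules G ->
         (X', [:: A; B']) \in rules G -> B = B')].

(* G' is G with one fresh nonterminal N added and with rule set R. *)
Definition extends (V : choiceType) (N : V) (R : V -> seq V -> Prop)
    (G G' : cfg V) : Prop :=
  [/\ N \notin nonterms G `|` terms G,
      nonterms G' = N |` nonterms G,
      terms G' = terms G,
      start G' = start G
    & forall X Y, (X, Y) \in rules G' <-> R X Y].

(* Rules after the N-terminal substitution of A for the rule A -> b. For a
   rule X -> AA, the rules X -> NA and X -> AN are the instances B := A of
   TS_left and TS_right. *)
Inductive term_subst_rules (V : choiceType) (G : cfg V) (A b N : V) :
    V -> seq V -> Prop :=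
| TS_new : term_subst_rules G A b N N [:: b]
| TS_keep X Y : (X, Y) \in rules G -> (X, Y) <> (A, [:: b]) ->
    term_subst_rules G A b N X Y
| TS_left X B : B \in nonterms G -> (X, [:: A; B]) \in rules G ->
    term_subst_rules G A b N X [:: N; B]
| TS_right X B : B \in nonterms G -> (X, [:: B; A]) \in rules G ->
    term_subst_rules G A b N X [:: B; N]
| TS_both X : (X, [:: A; A]) \in rules G ->
    term_subst_rules G A b N X [:: N; N].

Definition term_subst (V : choiceType) (A b N : V) (G G' : cfg V) : Prop :=
  extends N (term_subst_rules G A b N) G G'.

(* Rules after the N-nonterminal substitution of A which turns every
   right-hand side Z into Z' (Z' is Z with one occurrence of A replaced by N).
   The new nonterminal is named in the literature after the pair Z, hence it
   is shared by all the rules with right-hand side Z, including those that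
   rewrite A or N. *)
Inductive nonterm_subst_rules (V : choiceType) (G : cfg V) (A N : V)
    (Z Z' : seq V) : V -> seq V -> Prop :=
| NS_keep X Y : (X, Y) \in rules G ->
    nonterm_subst_rules G A N Z Z' X (if Y == Z then Z' else Y)
| NS_copy Y : (A, Y) \in rules G ->
    nonterm_subst_rules G A N Z Z' N (if Y == Z then Z' else Y).

Definition nonterm_subst (V : choiceType) (A N : V) (Z Z' : seq V)
    (G G' : cfg V) : Prop :=
  extends N (nonterm_subst_rules G A N Z Z') G G'.

Definition step1a (V : choiceType) (G G' : cfg V) : Prop :=
  exists A a b N,
    [/\ A <> start G, a \in terms G, b \in terms G & a <> b] /\
    [/\ (A, [:: a]) \in rules G, (A, [:: b]) \in rules G
      & term_subst A b N G G'].

Definition step1b (V : choiceType) (G G' : cfg V) : Prop :=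
  exists A a B1 B2 N,
    [/\ A <> start G, a \in terms G, (A, [:: a]) \in rules G,
        (A, [:: B1; B2]) \in rules G & term_subst A a N G G'].

Definition step2 (V : choiceType) (G G' : cfg V) : Prop :=
  exists X X' A B B' N,
    [/\ (X, [:: A; B]) \in rules G, (X', [:: B'; A]) \in rules G
      & nonterm_subst A N [:: B'; A] [:: B'; N] G G'].

Definition step3 (V : choiceType) (G G' : cfg V) : Prop :=
  exists X X' A A' B N, A <> A' /\
    ([/\ (X, [:: A; B]) \in rules G, (X', [:: A'; B]) \in rules G
       & nonterm_subst B N [:: A'; B] [:: A'; N] G G'] \/
     [/\ (X, [:: B; A]) \in rules G, (X', [:: B; A']) \in rules G
       & nonterm_subst B N [:: B; A'] [:: N; A'] G G']).

Definition exhaust (V : choiceType) (R : cfg V -> cfg V -> Prop)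
    (G G' : cfg V) : Prop :=
  clos_refl_trans (cfg V) R G G' /\ ~ exists G'', R G' G''.

Definition conversion_round (V : choiceType) (G G' : cfg V) : Prop :=
  exists G1 G2 G3,
    [/\ exhaust (@step1a V) G G1, exhaust (@step1b V) G1 G2,
        exhaust (@step2 V) G2 G3 & exhaust (@step3 V) G3 G'].

(* One pass yields Dyck normal form unless the axiom S has a rule S -> a and
   also occurs in right-hand sides: a copy of S made by a nonterminal
   substitution is then subject to the condition on terminal rules, from which
   S is exempt, and the steps have to be run again (e.g. S -> SS, S -> a). *)
Definition conversion (V : choiceType) : cfg V -> cfg V -> Prop :=
  clos_trans (cfg V) (@conversion_round V).

Inductive tree (L : Type) := Node of L & seq (tree L).

Definition label (L : Type) (t : tree L) : L := let: Node l _ := t in l.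

Fixpoint tree_map (L M : Type) (f : L -> M) (t : tree L) : tree M :=
  let: Node l ts := t in Node (f l) (map (tree_map f) ts).

(* Derivation trees have labels in option V, where None stands for the empty
   string. *)
Inductive deriv_tree (V : choiceType) (G : cfg V) : tree (option V) -> Prop :=
| DT_term a : a \in terms G -> deriv_tree G (Node (Some a) [::])
| DT_eps A : (A, [::]) \in rules G ->
    deriv_tree G (Node (Some A) [:: Node None [::]])
| DT_node A Y ts : (A, Y) \in rules G -> Y <> [::] ->
    map (@label (option V)) ts = map Some Y ->
    (forall t, List.In t ts -> deriv_tree G t) ->
    deriv_tree G (Node (Some A) ts).

Fixpoint yield (V : Type) (t : tree (option V)) : seq V :=
  match t with
  | Node None [::] => [::]
  | Node (Some a) [::] => [:: a]
  | Node _ ts => flatten (map (@yield V) ts)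
  end.

Definition deriv_tree_of (V : choiceType) (G : cfg V) (w : seq V)
    (t : tree (option V)) : Prop :=
  [/\ deriv_tree G t, label t = Some (start G) & yield t = w].

Definition hom_image (V : Type) (h : V -> V) (t : tree (option V)) :
    tree (option V) :=
  tree_map (omap h) t.

(* Main.v *)
Require Import Defs.
From mathcomp Require Import all_boot finmap.
From Stdlib Require Import Relation_Operators.

Set Implicit Arguments.
Unset Strict Implicit.

Local Open Scope fset_scope.

(** Each elementary substitution introduces one nonterminal [N] as a copy of a
    nonterminal [A]; let [h] send [N] back to [A] and fix everything else.
    After a terminal substitution a tree of the old grammar is lifted along [h]
    from the leaves upwards: the subtrees [A -> b] become [N -> b], and every
    choice of [A] or [N] on a right-hand side is available to the parent. After
    a nonterminal substitution it is lifted from the root downwards: [A] and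
    [N] have the same right-hand sides, so the label imposed by the parent can
    always be honoured. The axiom is never relabelled, and the map for the
    whole conversion is the composite of these maps. *)

(** * Relabelling of trees *)

Lemma tree_map_comp (K L M : Type) (f : L -> M) (g : K -> L) (t : tree K) :
  tree_map f (tree_map g t) = tree_map (f \o g) t.
Proof.
move: t; fix IH 1; case=> l ts /=; congr Node.
by elim: ts => //= t ts ->; rewrite IH.
Qed.

Lemma hom_image_comp (V : Type) (h k : V -> V) (t : tree (option V)) :
  hom_image h (hom_image k t) = hom_image (h \o k) t.
Proof.
rewrite /hom_image tree_map_comp.
move: t; fix IH 1; case=> l ts /=; congr Node; first by case: l.
by elim: ts => //= t ts ->; rewrite IH.
Qed.

Lemma hom_image_id (V : Type) (t : tree (option V)) : hom_image id t = t.
Proof.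
move: t; fix IH 1; case=> l ts; rewrite /hom_image /=; congr Node.
  by case: l.
by elim: ts => //= t ts ->; congr cons; apply: IH.
Qed.

Lemma label_hom_image (V : Type) (h : V -> V) (t : tree (option V)) :
  label (hom_image h t) = omap h (label t).
Proof. by case: t. Qed.

Lemma yield_hom_image (V : choiceType) (G : cfg V) (h : V -> V) t :
  {in terms G, h =1 id} -> deriv_tree G t -> yield (hom_image h t) = yield t.
Proof.
move=> hT; elim=> {t} [a aT|A _|A Y ts _ Y0 lab _ IH] //=.
  by rewrite hT.
(* A node without children would yield its own label, which [h] may change when it is a
   nonterminal. *)
have {Y0 lab} : ts <> [::] by move=> ts0; apply: Y0; case: Y lab; rewrite ts0.
case: ts IH => // t ts IH _ /=; congr (_ ++ flatten _).
  by apply: IH; left.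
have {IH} : forall s, List.In s ts -> yield (hom_image h s) = yield s.
  by move=> s sts; apply: IH; right.
elim: ts => //= s ts IHts IH; congr cons; first by apply: IH; left.
by apply: IHts => r rts; apply: IH; right.
Qed.

(** * Lifting derivation trees along a map of symbols *)

Section Lifting.

Variables (V : choiceType) (G G' : cfg V) (h : V -> V).
Hypothesis eqT : terms G' = terms G.

(** The lifted children fix the word [Y'] over the right-hand side, so the rule hypothesis must
    accept every preimage [Y']; the root is then determined only up to [h]. *)
Lemma lift_bottom_up :
  {in terms G, h =1 id} ->
  (forall X Y', (X, map h Y') \in rules G ->
     exists2 X', h X' = X & (X', Y') \in rules G') ->
  forall t, deriv_tree G t -> exists2 t', deriv_tree G' t' & t = hom_image h t'.
Proof.
move=> hT hR t; elim=> {t} [a aT|A AR|A Y ts AY Y0 lab _ IH].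
- exists (Node (Some a) [::]); first by apply: DT_term; rewrite eqT.
  by rewrite /hom_image /= hT.
- have [A' <- A'R] := hR A [::] AR.
  by exists (Node (Some A') [:: Node None [::]]); first exact: DT_eps.
have {lab IH} [Y' [ts' [eY ets lab' D]]] : exists Y' ts',
    [/\ Y = map h Y', ts = map (hom_image h) ts',
        map (@label (option V)) ts' = map Some Y'
      & forall t, List.In t ts' -> deriv_tree G' t].
  elim: ts Y {AY Y0} lab IH => [|t ts IHts] [|y Y] //= lab IH.
    by exists [::], [::].
  case: lab => ly lY.
  have [t' Dt' et] := IH t (or_introl erefl).
  have [|Y' [ts' [-> -> lab' D]]] := IHts Y lY.
    by move=> s sts; apply: IH; right.
  move: ly; rewrite et label_hom_image; case lt': (label t') => [y'|] //= [<-].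
  exists (y' :: Y'), (t' :: ts'); split=> //=; first by rewrite lt' lab'.
  by move=> s [<-|/D].
subst Y ts; have [A' <- A'R] := hR _ _ AY.
exists (Node (Some A') ts') => //; apply: (DT_node A'R) => //.
by move=> Y'0; apply: Y0; rewrite Y'0.
Qed.

(** Here the root label is prescribed: the rule hypothesis picks one preimage of the right-hand
    side, and its letters are prescribed to the children. The first hypothesis makes a label
    prescribed to a leaf the terminal itself. *)
Lemma lift_top_down :
  (forall x, h x \in terms G -> h x = x) ->
  (forall X' Y, (h X', Y) \in rules G ->
     exists2 Y', Y = map h Y' & (X', Y') \in rules G') ->
  forall t, deriv_tree G t -> forall x, label t = Some (h x) ->
    exists t', [/\ deriv_tree G' t', label t' = Some x & t = hom_image h t'].
Proof.
move=> hV hR t; elim=> {t} [a aT|A AR|A Y ts AY Y0 lab _ IH] x /= [ex]; subst.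
- exists (Node (Some x) [::]); split=> //.
  by apply: DT_term; rewrite eqT -(hV x aT).
(* Only the empty word maps to the empty word. *)
- have [[|y Y'] // _ xR] := hR x [::] AR.
  by exists (Node (Some x) [:: Node None [::]]); split=> //; apply: DT_eps.
have [Y' eY xY'] := hR _ _ AY; subst Y.
have {lab IH} [ts' [-> lab' D]] : exists ts',
    [/\ ts = map (hom_image h) ts',
        map (@label (option V)) ts' = map Some Y'
      & forall t, List.In t ts' -> deriv_tree G' t].
  elim: ts Y' {AY Y0 xY'} lab IH => [|t ts IHts] [|y Y'] //= lab IH.
    by exists [::].
  case: lab => ly lY.
  have [t' [Dt' lt' ->]] := IH t (or_introl erefl) y ly.
  have [|ts' [-> lab' D]] := IHts Y' lY.
    by move=> s sts; apply: IH; right.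
  exists (t' :: ts'); split=> //=; first by rewrite lt' lab'.
  by move=> s [<-|/D].
exists (Node (Some x) ts'); split=> //; apply: (DT_node xY') => //.
by move=> Y'0; apply: Y0; rewrite Y'0.
Qed.

End Lifting.

(* Chomsky normal form up to the restriction on empty rules; unlike [chomsky],
   it is preserved without knowing where the axiom occurs. *)
Definition weak_chomsky (V : choiceType) (G : cfg V) : Prop :=
  forall X Y, (X, Y) \in rules G ->
    [\/ exists B C, [/\ B \in nonterms G, C \in nonterms G & Y = [:: B; C]],
        exists2 a, a \in terms G & Y = [:: a]
      | Y = [::]].

Lemma chomsky_weak (V : choiceType) (G : cfg V) : chomsky G -> weak_chomsky G.
Proof.
by move=> cG X Y /cG [?|?|[_ -> _]]; [apply: Or31|apply: Or32|apply: Or33].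
Qed.

Lemma weak_chomsky_pair (V : choiceType) (G : cfg V) (X B C : V) :
  weak_chomsky G -> (X, [:: B; C]) \in rules G ->
  B \in nonterms G /\ C \in nonterms G.
Proof. by move=> cG /cG [[B' [C' [? ? [-> ->]]]]|[]|]. Qed.

Lemma nonterm_not_term (V : choiceType) (G : cfg V) (A : V) :
  A \in nonterms G -> A \notin terms G.
Proof. by move=> AN; apply: (fdisjointP (cfg_disjoint G)). Qed.

(** * Simulation of one grammar by another *)

Definition simulates (V : choiceType) (h : V -> V) (G G' : cfg V) : Prop :=
  [/\ terms G' = terms G,
      {in terms G, h =1 id},
      forall x, x \in nonterms G' `|` terms G ->
        h x \in nonterms G `|` terms G
    & forall t, deriv_tree G t -> label t = Some (start G) ->
        exists t', [/\ deriv_tree G' t', label t' = Some (start G')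
                     & t = hom_image h t']].

(** The weak normal form is an invariant carried along with the map, because the simulation of each
    step relies on it in the grammar where that step starts. *)
Definition simulated (V : choiceType) (G G' : cfg V) : Prop :=
  weak_chomsky G -> weak_chomsky G' /\ exists h, simulates h G G'.

Lemma simulated_refl (V : choiceType) (G : cfg V) : simulated G G.
Proof.
move=> cG; split=> //; exists id; split=> // t Dt lt.
by exists t; rewrite hom_image_id.
Qed.

Lemma simulated_trans (V : choiceType) (G1 G2 G3 : cfg V) :
  simulated G1 G2 -> simulated G2 G3 -> simulated G1 G3.
Proof.
move=> s12 s23 /s12 [/s23 [c3 [k [kT k1 kV kD]]] [h [hT h1 hV hD]]].
split=> //; exists (h \o k); split.
- by rewrite kT.
- by move=> a aT /=; rewrite k1 ?hT // h1.
- by move=> x xV; apply: hV; rewrite -hT; apply: kV; rewrite hT.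
move=> t Dt lt; have [t' [Dt' lt' ->]] := hD t Dt lt.
have [t'' [Dt'' lt'' ->]] := kD t' Dt' lt'.
by exists t''; rewrite hom_image_comp.
Qed.

(** * Sending the new nonterminal back to its original *)

Definition collapse (V : eqType) (N A x : V) : V := if x == N then A else x.

Section Substitution.

Variables (V : choiceType) (G G' : cfg V) (N A : V) (R : V -> seq V -> Prop).
Hypothesis GG' : extends N R G G'.
Hypothesis AG : A \in nonterms G.

Let h := collapse N A.

Lemma collapse_id x : x \in nonterms G `|` terms G -> h x = x.
Proof.
case: GG' => NG _ _ _ _ xG; rewrite /h /collapse; case: eqP => // xN.
by rewrite xN (negbTE NG) in xG.
Qed.

Lemma collapse_terms : {in terms G, h =1 id}.
Proof. by move=> a aT; apply: collapse_id; rewrite in_fsetU aT orbT. Qed.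

Lemma collapse_nonterms x : x \in nonterms G -> h x = x.
Proof. by move=> xN; apply: collapse_id; rewrite in_fsetU xN. Qed.

Lemma map_collapse_rhs X Y : (X, Y) \in rules G -> map h Y = Y.
Proof.
move=> /cfg_rules [_ YG]; rewrite -[RHS]map_id.
by apply/eq_in_map => y /YG /collapse_id.
Qed.

Lemma collapse_mem x :
  x \in nonterms G' `|` terms G -> h x \in nonterms G `|` terms G.
Proof.
case: GG' => _ -> _ _ _; rewrite !in_fsetU in_fset1 /h /collapse.
by case: eqP => //= _ _; rewrite AG.
Qed.

Lemma collapse_eq x : h x = x \/ x = N /\ h x = A.
Proof. by rewrite /h /collapse; case: eqP; [right|left]. Qed.

Lemma extends_nonterm x : x \in nonterms G -> x \in nonterms G'.
Proof. by case: GG' => _ -> _ _ _ xG; rewrite in_fsetU xG orbT. Qed.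

Lemma extends_new : N \in nonterms G'.
Proof. by case: GG' => _ -> _ _ _; rewrite in_fsetU in_fset1 eqxx. Qed.

Lemma extends_weak_chomsky X Y :
  weak_chomsky G -> (X, Y) \in rules G ->
  [\/ exists B C, [/\ B \in nonterms G', C \in nonterms G' & Y = [:: B; C]],
      exists2 a, a \in terms G' & Y = [:: a]
    | Y = [::]].
Proof.
case: (GG') => _ _ eT _ _ cG /cG [[B [C [BG CG ->]]]|[a aT ->]|->].
- by apply: Or31; exists B, C; split=> //; apply: extends_nonterm.
- by apply: Or32; exists a; rewrite ?eT.
- exact: Or33.
Qed.

End Substitution.

(** * Terminal and nonterminal substitutions *)

Lemma term_subst_simulated (V : choiceType) (G G' : cfg V) (A b N : V) :
  A <> start G -> b \in terms G -> (A, [:: b]) \in rules G ->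
  term_subst A b N G G' -> simulated G G'.
Proof.
move=> AS bT Ab E cG; have [NG _ eT eS eR] := E.
have AG : A \in nonterms G by case: (cfg_rules Ab).
have [new old] := (extends_new E, extends_nonterm E).
split.
  move=> X Y /eR [|X0 Y0 XY _|X0 B BG _|X0 B BG _|X0 _].
  - by apply: Or32; exists b; rewrite ?eT.
  - exact: (extends_weak_chomsky E cG XY).
  - by apply: Or31; exists N, B; split=> //; apply: old.
  - by apply: Or31; exists B, N; split=> //; apply: old.
  - by apply: Or31; exists N, N.
set h := collapse N A.
have hT : {in terms G, h =1 id} by apply: collapse_terms E.
exists h; split=> //; first exact: collapse_mem E AG.
move=> t Dt lt.
have hR X Y' : (X, map h Y') \in rules G ->
    exists2 X', h X' = X & (X', Y') \in rules G'.
  move=> XY; have hX : h X = X.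
    by apply: (collapse_nonterms A E); case: (cfg_rules XY).
  have [[B [C [BG CG eY]]]|[a aT eY]|eY] := cG _ _ XY;
    case: Y' XY eY => [|y [|z [|]]] //= XY.
  (* Each of [y] and [z] is either fixed by [h] or equal to [N]; the four combinations are the four
     kinds of rules with two symbols on the right. *)
  - move=> [eB eC]; exists X => //; apply/eR; rewrite -{}eB in BG.
    rewrite -{}eC in CG; have [hy|[ey hy]] := collapse_eq N A y;
      have [hz|[ez hz]] := collapse_eq N A z;
      rewrite -/h in hy hz; rewrite hy hz in XY BG CG; rewrite ?ey ?ez.
    + exact: TS_keep.
    + exact: TS_right.
    + exact: TS_left.
    + exact: TS_both.
  (* [N] collapses to the nonterminal [A], hence never to the terminal [a]. *)
  - case=> ea; have ya : y = a.
      have [<-|[_ hy]] := collapse_eq N A y; first by [].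
      by move: aT; rewrite -ea /h hy (negbTE (nonterm_not_term AG)).
    rewrite ea in XY; rewrite ya.
    (* The removed rule is replaced by [N -> b], at the price of relabelling the root. *)
    have [[-> ->]|ne] := (X, [:: a]) =P (A, [:: b]).
      exists N; first by rewrite /h /collapse eqxx.
      by apply/eR; apply: TS_new.
    by exists X => //; apply/eR; apply: TS_keep.
  - by exists X => //; apply/eR; apply: TS_keep.
have [t' Dt' et] := lift_bottom_up eT hT hR Dt.
exists t'; split=> //; move: lt; rewrite et label_hom_image eS.
case: (label t') => //= x [] hx; congr Some.
(* A root relabelled [N] would make [A] the axiom. *)
by have [<-|[_ hA]] := collapse_eq N A x; last by case: AS; rewrite -hA.
Qed.

(** Leaving open which of [B], [C] is the new symbol covers left and right replacement at once; all
    that matters is that the new right-hand side collapses to [Z]. *)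
Lemma nonterm_subst_simulated (V : choiceType) (G G' : cfg V) (A N : V) Z B C :
  A \in nonterms G ->
  map (collapse N A) [:: B; C] = Z ->
  {subset [:: B; C] <= N |` nonterms G} ->
  nonterm_subst A N Z [:: B; C] G G' -> simulated G G'.
Proof.
move=> AG eZ sub E cG; have [NG eN eT eS eR] := E.
split.
  have rhs X Y : (X, Y) \in rules G ->
     let Y' := if Y == Z then [:: B; C] else Y in
     [\/ exists B C, [/\ B \in nonterms G', C \in nonterms G' & Y' = [:: B; C]],
         exists2 a, a \in terms G' & Y' = [:: a]
       | Y' = [::]].
    move=> XY; case: eqP => _ /=.
      by apply: Or31; exists B, C; rewrite eN !sub ?inE ?eqxx ?orbT.
    exact: (extends_weak_chomsky E cG XY).
  by move=> X Y /eR [X0 Y0|Y0]; apply: rhs.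
set h := collapse N A.
have hT : {in terms G, h =1 id} by apply: collapse_terms E.
exists h; split=> //; first exact: collapse_mem E AG.
move=> t Dt lt.
have hV x : h x \in terms G -> h x = x.
  have [//|[_ hx]] := collapse_eq N A x.
  by rewrite /h hx (negbTE (nonterm_not_term AG)).
have hR X' Y : (h X', Y) \in rules G ->
    exists2 Y', Y = map h Y' & (X', Y') \in rules G'.
  (* A right-hand side other than [Z] lifts to itself: it is a word of [G], where the fresh [N] does
     not occur. *)
  move=> XY; exists (if Y == Z then [:: B; C] else Y).
    by case: eqP => [->|_]; rewrite ?eZ // (map_collapse_rhs A E XY).
  apply/eR; have [hX|[eX hX]] := collapse_eq N A X';
    move: XY; rewrite /h hX ?eX.
    exact: NS_keep.
  exact: NS_copy.
have lS : label t = Some (h (start G)).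
  by rewrite lt /h (collapse_nonterms A E (cfg_start G)).
have [t' [Dt' lt' ->]] := lift_top_down eT hV hR Dt lS.
by exists t'; rewrite eS.
Qed.

(** * The steps of the conversion and their composition *)

Lemma step1a_simulated (V : choiceType) (G G' : cfg V) :
  step1a G G' -> simulated G G'.
Proof.
by move=> [A [a [b [N [[AS _ bT _] [_ Ab]]]]]]; apply: term_subst_simulated.
Qed.

Lemma step1b_simulated (V : choiceType) (G G' : cfg V) :
  step1b G G' -> simulated G G'.
Proof.
by move=> [A [a [_ [_ [N [AS aT Aa _]]]]]]; apply: term_subst_simulated.
Qed.

(** Shared by [step2] and one half of [step3]. The case [B = A] is harmless: [B] belongs to [G], so
    it differs from [N] and collapses to itself. *)
Lemma nonterm_subst_right_simulated (V : choiceType) (G G' : cfg V) X A B N :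
  (X, [:: B; A]) \in rules G ->
  nonterm_subst A N [:: B; A] [:: B; N] G G' -> simulated G G'.
Proof.
move=> XBA E cG; have [BG AG] := weak_chomsky_pair cG XBA.
apply: (nonterm_subst_simulated AG _ _ E) => //.
  by rewrite /= (collapse_nonterms A E BG) /collapse eqxx.
by move=> x; rewrite !inE => /orP [] /eqP ->; rewrite ?BG ?eqxx ?orbT.
Qed.

Lemma nonterm_subst_left_simulated (V : choiceType) (G G' : cfg V) X A B N :
  (X, [:: A; B]) \in rules G ->
  nonterm_subst A N [:: A; B] [:: N; B] G G' -> simulated G G'.
Proof.
move=> XAB E cG; have [AG BG] := weak_chomsky_pair cG XAB.
apply: (nonterm_subst_simulated AG _ _ E) => //.
  by rewrite /= (collapse_nonterms A E BG) /collapse eqxx.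
by move=> x; rewrite !inE => /orP [] /eqP ->; rewrite ?BG ?eqxx ?orbT.
Qed.

Lemma step2_simulated (V : choiceType) (G G' : cfg V) :
  step2 G G' -> simulated G G'.
Proof.
by move=> [_ [X [A [_ [B [N [_]]]]]]]; apply: nonterm_subst_right_simulated.
Qed.

Lemma step3_simulated (V : choiceType) (G G' : cfg V) :
  step3 G G' -> simulated G G'.
Proof.
move=> [_ [X [_ [A [B [N [_ [[_]|[_]]]]]]]]].
  exact: nonterm_subst_right_simulated.
exact: nonterm_subst_left_simulated.
Qed.

Lemma exhaust_simulated (V : choiceType) (R : cfg V -> cfg V -> Prop) G G' :
  (forall G1 G2, R G1 G2 -> simulated G1 G2) -> exhaust R G G' ->
  simulated G G'.
Proof.
move=> sR [RGG' _]; elim: RGG' => [G1 G2 /sR|G1|G1 G2 G3 _ s12 _ s23] //.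
  exact: simulated_refl.
exact: simulated_trans s12 s23.
Qed.

Lemma conversion_simulated (V : choiceType) (G G' : cfg V) :
  conversion G G' -> simulated G G'.
Proof.
elim=> [G0 G4 [G1 [G2 [G3 [e1 e2 e3 e4]]]]|G1 G2 G3 _ s12 _ s23].
  apply: simulated_trans (exhaust_simulated _ e4); last exact: step3_simulated.
  apply: simulated_trans (exhaust_simulated _ e3); last exact: step2_simulated.
  apply: simulated_trans (exhaust_simulated _ e2); last exact: step1b_simulated.
  exact: exhaust_simulated (@step1a_simulated V) e1.
exact: simulated_trans s12 s23.
Qed.

Theorem corollary1p4 (V : choiceType) (G G' : cfg V) :
  chomsky G ->
  dyck G' ->
  (forall w, lang G' w <-> lang G w) ->
  conversion G G' ->
  exists h : V -> V,
    (forall x, x \in nonterms G' `|` terms G -> h x \in nonterms G `|` terms G) /\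
    (forall w t, lang G w -> deriv_tree_of G w t ->
       exists2 t', deriv_tree_of G' w t' & t = hom_image h t').
Proof.
move=> cG _ _ /conversion_simulated /(_ (chomsky_weak cG)).
move=> [_ [h [eT hT hV hD]]]; exists h; split=> // w t _ [Dt lt <-].
have [t' [Dt' lt' ->]] := hD t Dt lt; exists t' => //; split=> //.
by rewrite (yield_hom_image (G := G')) ?eT.
Qed.
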